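(* Let $\mathcal{S}$ be a semi-ring of subsets of a set $\Omega$. The space $$\mathrm{ca}(\mathcal{S}):=\{\mu:\mathcal{S}\to\mathbb{R}\;:\;\mu\text{ is a signed measure and }|\mu|\text{ is finite}\},$$ with the pointwise vector space operations and the pointwise order, is a Dedekind complete Riesz space.
   Context: A semi-ring $\mathcal{S}$ of subsets of $\Omega$ is a family with $\emptyset\in\mathcal{S}$, closed under finite intersections, and such that for $A,B\in\mathcal{S}$ the set $A\setminus B$ is a finite disjoint union of elements of $\mathcal{S}$. A signed charge on $\mathcal{S}$ is a set function $\mu:\mathcal{S}\to[-\infty,\infty]$ with $\mu(\emptyset)=0$ that avoids at least one of the values $+\infty,-\infty$ and is finitely additive (for finite families of pairwise disjoint elements of $\mathcal{S}$ whose union is in $\mathcal{S}$). A signed measure is a countably additive signed charge, i.e. $\mu(\bigcup_n A_n)=\sum_n\mu(A_n)$ for every sequence of pairwise disjoint elements of $\mathcal{S}$ with union in $\mathcal{S}$. The order is $\mu\le\nu\iff\mu(A)\le\nu(A)$ for all $A\in\mathcal{S}$. The variation of $\mu$ is $|\mu|:=\sup\{-\mu,\mu\}$ (least upper bound among signed charges), given explicitly by $|\mu|(A)=\sup_{\Pi}\sum_{C\in\Pi}|\mu(C)|$, where $\Pi$ ranges over all finite partitions of $A$ by elements of $\mathcal{S}$; it is finite if it takes only finite values. A Riesz space is Dedekind complete if every nonempty subset bounded above has a supremum. *)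

(* Defs.v *)
From HB Require Import structures.
From mathcomp Require Import all_boot all_order all_algebra.
From mathcomp Require Import mathcomp_extra boolp classical_sets functions.
From mathcomp Require Import cardinality reals ereal topology normedtype.
From mathcomp Require Import sequences measure.
Import Order.TTheory GRing.Theory Num.Theory numFieldNormedType.Exports.

Set Implicit Arguments.
Unset Strict Implicit.
Unset Printing Implicit Defensive.

Local Open Scope classical_set_scope.
Local Open Scope ring_scope.

(* [le] is only compared on [E]: these are suprema and infima computed in
   the ordered set [E]. *)
Definition is_lub_in (V : Type) (E : set V) (le : V -> V -> Prop)
    (B : set V) (s : V) : Prop :=
  [/\ E s, (forall v, B v -> le v s)
    & forall w, E w -> (forall v, B v -> le v w) -> le s w].

Definition is_glb_in (V : Type) (E : set V) (le : V -> V -> Prop)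
    (B : set V) (s : V) : Prop :=
  is_lub_in E (fun u v => le v u) B s.

(* The vector space is the linear subspace [E] of the ambient module [V],
   with the operations of [V]. *)
Record riesz_space (R : realType) (V : lmodType R) (E : set V)
    (le : V -> V -> Prop) : Prop := {
  riesz_submod : submod_closed (mem E : {pred V});
  riesz_refl : forall u, E u -> le u u;
  riesz_anti : forall u v, E u -> E v -> le u v -> le v u -> u = v;
  riesz_trans : forall u v w, E u -> E v -> E w ->
    le u v -> le v w -> le u w;
  riesz_add : forall u v w, E u -> E v -> E w ->
    le u v -> le (u + w) (v + w);
  riesz_scale : forall (a : R) u v, E u -> E v -> 0 <= a ->
    le u v -> le (a *: u) (a *: v);
  riesz_sup : forall u v, E u -> E v ->
    exists s, is_lub_in E le [set u; v] s;
  riesz_inf : forall u v, E u -> E v ->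
    exists s, is_glb_in E le [set u; v] s }.

Definition dedekind_complete (V : Type) (E : set V)
    (le : V -> V -> Prop) : Prop :=
  forall B : set V, B `<=` E -> B !=set0 ->
    (exists2 w, E w & forall v, B v -> le v w) ->
    exists s, is_lub_in E le B s.

Definition pointwise_le (T : Type) (d : Order.disp_t) (K : porderType d)
    (f g : T -> K) : Prop := forall x, (f x <= g x)%O.

(* The bundled [semiRingOfSetsType] would force [Omega] to be nonempty. *)
Definition semi_ring (Omega : Type) (S : set (set Omega)) : Prop :=
  [/\ S set0, setI_closed S & semi_setD_closed S].

Section set_functions.
Context (R : realType) (Omega : Type) (S : set (set Omega)).

(* Set functions have domain the subtype [S] (through the coercion
   [set_type]), so that Leibniz equality of set functions is equality on [S].
   Empty pieces are allowed; they do not matter as [mu set0 = 0]. *)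
Definition is_partition (I : Type) (C : I -> S) (A : S) : Prop :=
  trivIset setT (fun i => \val (C i)) /\ \val A = \bigcup_i \val (C i).

Definition finitely_additive (mu : S -> \bar R) : Prop :=
  forall (n : nat) (C : 'I_n -> S) (A : S), is_partition C A ->
    mu A = (\sum_(i < n) mu (C i))%E.

Definition countably_additive (mu : S -> \bar R) : Prop :=
  forall (C : nat -> S) (A : S), is_partition C A ->
    (fun n => \sum_(0 <= i < n) mu (C i))%E @ \oo --> mu A.

Definition signed_charge (mu : S -> \bar R) : Prop :=
  [/\ (forall A, \val A = set0 -> mu A = 0%E),
      (forall A, mu A != +oo%E) \/ (forall A, mu A != -oo%E)
    & finitely_additive mu].

Definition signed_measure (mu : S -> \bar R) : Prop :=
  signed_charge mu /\ countably_additive mu.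

(* The least upper bound of [mu] and [- mu] among signed charges, see
   [variation_is_lub] below. *)
Definition variation (mu : S -> \bar R) (A : S) : \bar R :=
  ereal_sup [set x | exists n (C : 'I_n -> S),
    is_partition C A /\ x = (\sum_(i < n) `|mu (C i)|)%E].

Definition ca : set (S -> R^o) :=
  [set mu | signed_measure (fun A => (mu A)%:E) /\
    forall A, variation (fun A => (mu A)%:E) A \is a fin_num].

End set_functions.
Arguments ca R {Omega} S.

Section variation_theory.
Context (R : realType) (Omega : Type) (S : set (set Omega)).
Implicit Types (mu nu : S -> \bar R) (A B : S).
Local Open Scope ereal_scope.

Lemma is_partition_enum (I : finType) (C : I -> S) A :
  is_partition C A -> is_partition (fun i : 'I_#|I| => C (enum_val i)) A.
Proof.
move=> [tC AC]; split.
  by move=> i j _ _ CCx; apply: enum_val_inj; apply: tC CCx.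
rewrite AC; apply/seteqP; split => x [i _ Cix]; last by exists (enum_val i).
by exists (enum_rank i) => //=; rewrite enum_rankK.
Qed.

Lemma sum_enum_val (I : finType) (F : I -> \bar R) :
  \sum_(i < #|I|) F (enum_val i) = \sum_i F i.
Proof. by rewrite -(big_enum_val (A := I)). Qed.

Lemma finitely_additive_fintype mu : finitely_additive mu ->
  forall (I : finType) (C : I -> S) A, is_partition C A ->
    mu A = \sum_i mu (C i).
Proof.
move=> fmu I C A /is_partition_enum/fmu ->.
exact: (sum_enum_val (fun i => mu (C i))).
Qed.

Lemma sum_le_variation mu A (I : finType) (C : I -> S) :
  is_partition C A -> \sum_i `|mu (C i)| <= variation mu A.
Proof.
move=> /is_partition_enum pC; apply: ereal_sup_ubound.
exists #|I|, (fun i => C (enum_val i)); split => //.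
by rewrite (sum_enum_val (fun i => `|mu (C i)|)).
Qed.

Lemma is_partition1 A : is_partition (fun _ : 'I_1 => A) A.
Proof.
split; first by move=> i j _ _ _; rewrite !ord1.
by apply/seteqP; split => [x Ax|x []//]; exists ord0.
Qed.

Lemma abse_le_variation mu A : `|mu A| <= variation mu A.
Proof.
by have := sum_le_variation mu (is_partition1 A); rewrite big_ord1.
Qed.

Lemma variation_ge0 mu A : 0 <= variation mu A.
Proof. exact: le_trans (abse_le_variation mu A). Qed.

Lemma add_ereal_sup_le (F : set (\bar R)) (c z : \bar R) :
  (forall x, F x -> 0 <= x) -> F !=set0 -> 0 <= c ->
  (forall x, F x -> x + c <= z) -> ereal_sup F + c <= z.
Proof.
move=> F0 [x0 Fx0] c0 Fz; have [cfin|] := boolP (c \is a fin_num).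
  rewrite -leeBrDr//; apply: ge_ereal_sup => x Fx.
  by rewrite leeBrDr// Fz.
rewrite ge0_fin_numE// -leNgt leye_eq => /eqP cy.
move: (Fz _ Fx0); rewrite cy addey ?gt_eqF ?(lt_le_trans _ (F0 _ Fx0))//.
by rewrite leye_eq => /eqP ->; rewrite leey.
Qed.

Lemma sum_ereal_sup_le (I : eqType) (r : seq I) (F : I -> set (\bar R))
    (c z : \bar R) :
  uniq r -> (forall i x, F i x -> 0 <= x) -> (forall i, F i !=set0) -> 0 <= c ->
  (forall f, (forall i, F i (f i)) -> \sum_(i <- r) f i + c <= z) ->
  \sum_(i <- r) ereal_sup (F i) + c <= z.
Proof.
move=> + F0 Fn0; elim: r c => [c _ c0 Fz|a r IH c /andP[ar ur] c0 Fz].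
  have /choice[f Ff] := Fn0.
  by move: (Fz f Ff); rewrite !big_nil.
have sup0 i : 0 <= ereal_sup (F i).
  have [x Fx] := Fn0 i; apply: le_trans (F0 _ _ Fx) _.
  exact: ereal_sup_ubound.
rewrite big_cons -addeA; apply: add_ereal_sup_le => //.
- exact: F0.
- by rewrite adde_ge0// sume_ge0.
move=> x Fx; rewrite addeCA; apply: IH => // [|f Ff].
  by rewrite adde_ge0//; exact: F0 Fx.
pose g i := if i == a then x else f i.
have /Fz : forall i, F i (g i) by move=> i; rewrite /g; case: eqP => [->|].
rewrite big_cons {1}/g eqxx -addeA addeCA.
congr (_ + _ <= _); apply: eq_big_seq => i ir.
by rewrite /g; case: eqP => // ia; move: ar; rewrite -ia ir.
Qed.

Lemma variation_finitely_additive mu : semi_ring S -> signed_charge mu ->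
  finitely_additive (variation mu).
Proof.
move=> [_ SI _] [_ _ amu] n D B [tD BD]; apply/eqP; rewrite eq_le.
apply/andP; split.
  apply: ge_ereal_sup => _ [m [C [[tC BC] ->]]].
  have SCD j i : S (\val (C j) `&` \val (D i)).
    by apply: SI; apply: set_mem; exact: valP.
  pose E j i : S := exist (fun X => X \in S) _ (mem_set (SCD j i)).
  have Ej j : mu (C j) = \sum_(i < n) mu (E j i).
    apply: amu; split => [i k _ _ [x [[_ Dix] [_ Dkx]]]|].
      by apply: tD => //; exists x.
    rewrite -setI_bigcupr -BD; apply/esym/setIidPl.
    by rewrite BC => x Cx; exists j.
  have Ei i : is_partition (fun j => E j i) (D i).
    split => [j k _ _ [x [[Cjx _] [Ckx _]]]|].
      by apply: tC => //; exists x.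
    rewrite -setI_bigcupl -BC; apply/esym/setIidPr.
    by rewrite BD => x Dx; exists i.
  apply: (@le_trans _ _ (\sum_(j < m) \sum_(i < n) `|mu (E j i)|)).
    by apply: lee_sum => j _; rewrite Ej lee_abs_sum.
  by rewrite exchange_big lee_sum// => i _; exact: sum_le_variation (Ei i).
rewrite -[leLHS]adde0; apply: sum_ereal_sup_le => //.
- exact: index_enum_uniq.
- by move=> i _ [m [C [_ ->]]]; rewrite sume_ge0.
- move=> i; exists (\sum_(j < 1) `|mu (D i)|), 1%N, (fun=> D i).
  by split => //; exact: is_partition1.
move=> f Ff; rewrite adde0.
pose m i := projT1 (cid (Ff i)).
have /= mP i : exists C : 'I_(m i) -> S,
  is_partition C (D i) /\ f i = \sum_(j < m i) `|mu (C j)| := projT2 (cid (Ff i)).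
pose C i := projT1 (cid (mP i)).
have CP i : is_partition (C i) (D i) := (projT2 (cid (mP i))).1.
have fE i : f i = \sum_(j < m i) `|mu (C i j)| := (projT2 (cid (mP i))).2.
have pB : is_partition (fun u : {i : 'I_n & 'I_(m i)} => C (tag u) (tagged u)) B.
  split.
    move=> [i j] [k l] _ _ /= [x [Cijx Cklx]].
    have CD i' j' : \val (C i' j') `<=` \val (D i').
      by rewrite (CP i').2 => y Cy; exists j'.
    have ik : i = k by apply: tD => //; exists x; split; apply: CD; eassumption.
    move: l Cklx; rewrite -ik => l Cilx; congr existT.
    by apply: (CP i).1 => //; exists x.
  rewrite BD; apply/seteqP; split => [x [i _]|x [[i j] _ /= Cx]].
    by rewrite (CP i).2 => -[j _ Cx]; exists (existT _ i j).
  by exists i => //; rewrite (CP i).2; exists j.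
apply: le_trans (sum_le_variation mu pB).
rewrite (eq_bigr _ (fun i _ => fE i)).
by rewrite (sig_big_dep _ (fun=> xpredT) (fun i j => `|mu (C i j)|)).
Qed.

Lemma signed_charge_variation mu : semi_ring S -> signed_charge mu ->
  signed_charge (variation mu).
Proof.
move=> rS cmu; have av := variation_finitely_additive rS cmu; split => //.
  move=> A A0; rewrite (av 0%N (fun=> A) A); first by rewrite big_ord0.
  by split=> [[]//|]; rewrite A0; apply/seteqP; split => x // [[]].
by right=> A; rewrite -ltNye; apply: lt_le_trans (variation_ge0 mu A).
Qed.

Lemma variation_is_lub mu : semi_ring S -> signed_charge mu ->
  is_lub_in [set nu : S -> \bar R | signed_charge nu] (@pointwise_le _ _ _)
    [set (fun A => - mu A); mu] (variation mu).
Proof.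
move=> rS cmu; split; first exact: signed_charge_variation.
  move=> _ [|] -> A; apply: le_trans (abse_le_variation mu A).
    by rewrite -abseN lee_abs.
  exact: lee_abs.
move=> nu [_ _ anu] munu A; apply: ge_ereal_sup => _ [n [C [pC ->]]].
rewrite (anu _ _ _ pC); apply: lee_sum => i _.
have := munu mu (or_intror erefl) (C i).
have := munu _ (or_introl erefl) (C i).
have [?|?] := leP 0 (mu (C i)); first by rewrite gee0_abs.
by rewrite lte0_abs.
Qed.

End variation_theory.

(* Main.v *)
Require Import Defs.
From mathcomp Require Import all_boot all_order all_algebra.
From mathcomp Require Import boolp classical_sets functions.
From mathcomp Require Import cardinality reals ereal topology normedtype.
From mathcomp Require Import sequences lra.
Import Order.TTheory GRing.Theory Num.Theory numFieldNormedType.Exports.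

(** The heart of the matter is a formula for the supremum of a nonempty family
[B] of [ca S] that lies below some finitely additive real function [w]:
  [s A = sup (\sum_i f_i (C_i))],
the supremum over all finite partitions [C] of [A] and all choices of members
[f_i] of [B], one for each piece. The sums are at most [w A] by additivity of
[w], and the same computation shows that [s] is below every additive upper
bound of [B], hence that it is the least one as soon as it lies in [ca S]:

- [s] is finitely additive ([charge_on_partition_sup]): intersecting a
  partition of [A] with a given partition [D] of [A] does not change its sum,
  and conversely partitions of the pieces [D_i] combine into one of [A].

- [s] is countably additive ([sigma_additive_on_partition_sup]). Let [D] be a
  countable partition of [A]. A sum [\sum_j f_j (C_j)] close to [s A] is the
  limit of the [\sum_(k < n) \sum_j f_j (C_j `&` D_k)], which are at most
  [\sum_(k < n) s (D_k)]. For the opposite inequality fix [b] in [B]; then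
  [s - b] is a nonnegative charge, so that its sum over [D_0, ..., D_(n-1)] is
  at most its value at [A] ([charge_on_sum_le]), and the corresponding partial
  sums of [b] converge to [b A].

- the variation of [s] is finite
  ([partition_sup_bounded_variation]), because
  [`|s| <= `|b| + (s - b) <= `|b| + (w - b)] and [w - b] is additive.

For Dedekind completeness take for [w] the given upper bound. For the supremum
of two elements [u] and [v] take the sum of their variations; as [w] need only
be finitely additive, the countable additivity of variations never comes in.
Infima are obtained from suprema by negation. *)

Set Implicit Arguments.
Unset Strict Implicit.
Unset Printing Implicit Defensive.

Local Open Scope classical_set_scope.
Local Open Scope ring_scope.

(** * Partitions in a semi-ring *)

Section partitions.
Context (Omega : Type) (S : set (set Omega)) (hS : semi_ring S).
Implicit Types A B : S.

Lemma semi_ring_setI A B : S (\val A `&` \val B).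
Proof.
by have [_ SI _] := hS; apply: SI; apply: set_mem; exact: valP.
Qed.

Definition meet A B : S :=
  exist (fun X => X \in S) _ (mem_set (semi_ring_setI A B)).

Lemma meetC A B : meet A B = meet B A.
Proof. by apply: val_inj; rewrite /= setIC. Qed.

Lemma partition_subset (I : Type) (C : I -> S) A i :
  is_partition C A -> \val (C i) `<=` \val A.
Proof. by move=> [_ ->] x Cx; exists i. Qed.

(** The intersections with a disjoint cover of [B] partition [B]. The cover may
be infinite, and may be larger than [B]. *)
Lemma is_partition_meet (I : Type) (D : I -> S) B :
  trivIset setT (fun i => \val (D i)) ->
  \val B `<=` \bigcup_i \val (D i) ->
  is_partition (fun i => meet B (D i)) B.
Proof.
move=> tD BD; split => [i k _ _ [x [[_ Dix] [_ Dkx]]]|].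
  by apply: tD => //; exists x.
by rewrite /= -setI_bigcupr; apply/esym/setIidPl.
Qed.

Lemma is_partition_meetl (I : Type) (D : I -> S) A B : is_partition D A ->
  \val B `<=` \val A -> is_partition (fun i => meet B (D i)) B.
Proof. by move=> [tD AD] BA; apply: is_partition_meet; rewrite -?AD. Qed.

(** The semi-ring axiom for differences yields a finite set of pieces; a family
indexed by a finite type is what sums over the pieces need. *)
Lemma semi_ring_setD_fintype A B : exists (L : finType) (E : L -> S),
  trivIset setT (fun l => \val (E l)) /\
  \val A `\` \val B = \bigcup_l \val (E l).
Proof.
have [_ _ SD] := hS; have /SD : S (\val A) by apply: set_mem; exact: valP.
have SB : S (\val B) by apply: set_mem; exact: valP.
move=> /(_ _ SB) [D [/finite_seqP[s Ds] DS ABD tD]].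
have sS (l : seq_sub s) : ssval l \in S.
  by apply/mem_set/DS; rewrite Ds /=; exact: ssvalP.
exists (seq_sub s), (fun l => exist (fun X => X \in S) _ (sS l)); split.
  move=> i j _ _ /= ij; apply: val_inj => /=.
  by apply: tD => //; rewrite Ds /=; exact: ssvalP.
rewrite ABD Ds; apply/seteqP; split => [x [X /= Xs Xx]|x [l _ /= lx]].
  by exists (SeqSub Xs).
by exists (ssval l) => //=; exact: ssvalP.
Qed.

Lemma is_partition_bigcup (I : Type) (J : I -> Type) (D : I -> S) A
    (C : forall i, J i -> S) :
  is_partition D A -> (forall i, is_partition (C i) (D i)) ->
  is_partition (fun u : {i & J i} => C (projT1 u) (projT2 u)) A.
Proof.
move=> pD pC; split.
  move=> [i j] [k l] _ _ /= [x [Cijx Cklx]].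
  have ik : i = k.
    by apply: pD.1 => //; exists x; split;
      apply: partition_subset (pC _) _ _; eassumption.
  move: l Cklx; rewrite -ik => l Cilx; congr existT.
  by apply: (pC i).1 => //; exists x.
rewrite pD.2; apply/seteqP; split => [x [i _]|x [[i j] _ /= Cx]].
  by rewrite (pC i).2 => -[j _ Cx]; exists (existT _ i j).
by exists i => //; rewrite (pC i).2; exists j.
Qed.

End partitions.

(** * Real-valued charges and measures *)

Section real_set_functions.
Context (R : realType) (Omega : Type) (S : set (set Omega)).
Implicit Types (mu nu : S -> R) (A : S).

(** Indexing by arbitrary finite types rather than by ordinals lets partitions
be indexed by pairs, options and dependent sums without renumbering;
[charge_on_finitely_additive] shows that nothing changes. *)
Definition charge_on mu := forall (I : finType) (C : I -> S) A,
  is_partition C A -> mu A = \sum_i mu (C i).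

Definition sigma_additive_on mu := forall (C : nat -> S) A,
  is_partition C A -> (fun n => \sum_(0 <= k < n) mu (C k)) @ \oo --> mu A.

Definition locally_bounded_variation mu := forall A, exists M : R,
  forall (I : finType) (C : I -> S), is_partition C A ->
    \sum_i `|mu (C i)| <= M.

Lemma charge_on_finitely_additive mu :
  charge_on mu <-> finitely_additive (fun A => (mu A)%:E).
Proof.
split=> [amu n C A /amu ->|/finitely_additive_fintype amu I C A /amu].
  by rewrite sumEFin.
by rewrite sumEFin => -[].
Qed.

Lemma charge_on_set0 mu A : charge_on mu -> \val A = set0 -> mu A = 0.
Proof.
move=> amu A0; rewrite (amu 'I_0 (fun=> A)); first by rewrite big_ord0.
by split=> [[]//|]; rewrite A0; apply/seteqP; split => x // [[]].
Qed.

(** Membership in [ca] freed of extended reals: a real function never takes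
infinite values, and its variation at [A], being nonnegative, is finite
exactly when the sums of which it is the supremum have a common real bound. *)
Lemma caP mu : ca R S mu <->
  [/\ charge_on mu, sigma_additive_on mu & locally_bounded_variation mu].
Proof.
split=> [[[[_ _ amu] smu] bmu]|[amu smu bmu]]; split.
- exact/charge_on_finitely_additive.
- move=> C A /smu; under eq_fun do rewrite sumEFin.
  by move=> /fine_cvgP[].
- move=> A; exists (fine (variation (fun A => (mu A)%:E) A)) => I C pC.
  rewrite -lee_fin fineK//; apply: le_trans (sum_le_variation _ pC).
  by rewrite sumEFin.
- split.
  + split; first by move=> A A0; rewrite (charge_on_set0 amu).
    * by left.
    * exact/charge_on_finitely_additive.
  + move=> C A /smu mucvg; under eq_fun do rewrite sumEFin.
    by apply/fine_cvgP; split => //; near=> n.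
- move=> A; have [M MP] := bmu A.
  rewrite ge0_fin_numE ?variation_ge0//.
  apply: (@le_lt_trans _ _ M%:E); last by rewrite ltry.
  apply: ge_ereal_sup => _ [n [C [/MP CM ->]]].
  by rewrite sumEFin lee_fin.
Unshelve. all: by end_near. Qed.

Lemma charge_on_lincomb (a : R) mu nu : charge_on mu -> charge_on nu ->
  charge_on (fun A => a * mu A + nu A).
Proof.
by move=> amu anu I C A pC; rewrite (amu _ _ _ pC) (anu _ _ _ pC)
  big_split mulr_sumr.
Qed.

Lemma ca_submod_closed : submod_closed (mem (ca R S) : {pred S -> R^o}).
Proof.
split=> [|a u v].
  apply/mem_set/caP; split=> [I C A _|C A _|A].
  - by rewrite big1.
  - by under eq_fun do rewrite big1//; exact: cvg_cst.
  - by exists 0 => I C _; rewrite big1 => // i _; rewrite normr0.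
move=> /set_mem/caP[au su bu] /set_mem/caP[av sv bv].
apply/mem_set/caP; split; first exact: charge_on_lincomb.
  move=> C A pC; have -> : (fun n => \sum_(0 <= k < n) (a *: u + v) (C k)) =
    (fun n => a * (\sum_(0 <= k < n) u (C k)) + \sum_(0 <= k < n) v (C k)).
    by apply/funext => n; rewrite mulr_sumr -big_split.
  by apply: cvgD (sv _ _ pC); apply: cvgM (su _ _ pC); exact: cvg_cst.
move=> A; have [M MP] := bu A; have [N NP] := bv A.
exists (`|a| * M + N) => I C pC.
apply: (@le_trans _ _ (\sum_i (`|a| * `|u (C i)| + `|v (C i)|))).
  by apply: ler_sum => i _; rewrite -normrM; exact: ler_normD.
by rewrite big_split -mulr_sumr lerD ?NP// ler_wpM2l// MP.
Qed.

End real_set_functions.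

(** * Superadditivity of nonnegative charges *)

Section superadditivity.
Context (R : realType) (Omega : Type) (S : set (set Omega)).
Context (hS : semi_ring S).
Implicit Types (p : S -> R) (A : S).

(** Removing one set from an element of [S] leaves a finite disjoint family
instead of an element of [S], so the induction on the number of removed sets
works only for a disjoint family [E] in place of a single set. In the step,
[D n] is cut out of every [E k]: the parts [E k `&` D n] make up [D n], and
the pieces [F k l] of the differences still cover the other [D i]. *)
Lemma charge_on_sum_le_cover p (n : nat) (D : nat -> S) (K : finType)
    (E : K -> S) :
  charge_on p -> (forall A, 0 <= p A) -> trivIset setT (fun i => \val (D i)) ->
  trivIset setT (fun k => \val (E k)) ->
  (forall i, (i < n)%N -> \val (D i) `<=` \bigcup_k \val (E k)) ->
  \sum_(0 <= i < n) p (D i) <= \sum_k p (E k).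
Proof.
move=> ap p0 tD; elim: n K E => [|n IH] K E tE DE.
  by rewrite big_nil sumr_ge0.
rewrite big_nat_recr//= addrC.
have /choice[g gP] : forall k, exists g : {L : finType & L -> S},
    trivIset setT (fun l => \val (projT2 g l)) /\
    \val (E k) `\` \val (D n) = \bigcup_l \val (projT2 g l).
  move=> k; have [L [F FP]] := semi_ring_setD_fintype hS (E k) (D n).
  by exists (existT _ L F).
pose F k := projT2 (g k).
have FE k l : \val (F k l) `<=` \val (E k) `\` \val (D n).
  by rewrite (gP k).2 => x Fx; exists l.
(* [None] indexes the part inside [D n], [Some l] the pieces outside. *)
have pE k : is_partition
    (fun o => if o is Some l then F k l else meet hS (E k) (D n)) (E k).
  split.
    move=> [i|] [j|] _ _ //= [x [xi xj]].
    - by congr Some; apply: (gP k).1 => //; exists x.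
    - by have [_] := FE _ _ _ xi; case: xj.
    - by have [_] := FE _ _ _ xj; case: xi.
  apply/seteqP; split => [x Ex|x [[l|] _ /=]]; last 2 first.
  - by move=> /FE[].
  - by case.
  have [Dx|Dx] := pselect (\val (D n) x); first by exists None.
  have : (\val (E k) `\` \val (D n)) x by [].
  by rewrite (gP k).2 => -[l _ Fx]; exists (Some l).
have -> : \sum_k p (E k) = \sum_k p (meet hS (E k) (D n)) +
    \sum_k \sum_l p (F k l).
  rewrite -big_split; apply: eq_bigr => k _ /=.
  rewrite (ap _ _ _ (pE k)) (bigD1 None)//=; congr (_ + _).
  rewrite [LHS](reindex_omap Some id)//=; last by case.
  by apply: eq_bigl => l; rewrite eqxx.
apply: lerD.
  rewrite (ap _ (fun k => meet hS (E k) (D n)) (D n))//.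
  under [X in is_partition X]funext do rewrite meetC.
  by apply: is_partition_meet => //; exact: DE.
rewrite (sig_big_dep _ (fun=> xpredT) (fun k l => p (F k l))).
apply: IH => [[i k] [j l] _ _ /= [x [xi xj]]|i ltin x Dx].
  have ij : i = j.
    by apply: tE => //; exists x; split;
      [have [] := FE _ _ _ xi|have [] := FE _ _ _ xj].
  move: l xj; rewrite -ij => l xj; congr existT.
  by apply: (gP i).1 => //; exists x.
have [k _ Ex] := DE i (ltnW ltin) x Dx.
have : (\val (E k) `\` \val (D n)) x.
  split => // Dnx; move: ltin; rewrite (_ : i = n) ?ltnn//.
  by apply: tD => //; exists x.
by rewrite (gP k).2 => -[l _ Fx]; exists (existT _ k l).
Qed.

Lemma charge_on_sum_le p (D : nat -> S) A n :
  charge_on p -> (forall A, 0 <= p A) -> is_partition D A ->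
  \sum_(0 <= i < n) p (D i) <= p A.
Proof.
move=> ap p0 pD.
have -> : p A = \sum_(k < 1) p A by rewrite big_ord1.
apply: (charge_on_sum_le_cover ap p0 pD.1 (is_partition1 A).1) => i _.
by rewrite -(is_partition1 A).2; exact: partition_subset pD.
Qed.

End superadditivity.

(** * The supremum over finite partitions *)

(** Suprema over independent choices add up: choose [f i] within
[e / (#|I| + 1)] of the supremum of [F i], the [+ 1] covering an empty [I]. *)
Lemma sum_sup_le (R : realType) (I : finType) (F : I -> set R) (z : R) :
  (forall i, has_sup (F i)) ->
  (forall f, (forall i, F i (f i)) -> \sum_i f i <= z) ->
  \sum_i sup (F i) <= z.
Proof.
move=> supF Fz; apply/ler_addgt0Pr => e e0.
have d0 : 0 < e / #|I|.+1%:R by rewrite divr_gt0.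
have /choice[f fP] : forall i, exists x,
    F i x /\ sup (F i) - e / #|I|.+1%:R < x.
  by move=> i; have [x] := sup_adherent d0 (supF i); exists x.
have {}Fz := Fz f (fun i => (fP i).1).
apply: (@le_trans _ _ (\sum_i (f i + e / #|I|.+1%:R))).
  by apply: ler_sum => i _; rewrite -lerBlDr ltW// (fP i).2.
rewrite big_split lerD//= sumr_const -[leLHS]mulr_natr mulrAC ler_pdivrMr//.
by rewrite ler_wpM2l ?ler_nat// ltW.
Qed.

Section partition_sup.
Context (R : realType) (Omega : Type) (S : set (set Omega)).
Context (hS : semi_ring S) (B : set (S -> R)) (w b : S -> R).
Context (Ba : forall f, B f -> charge_on f) (aw : charge_on w) (Bb : B b)
  (Bw : forall f, B f -> forall A, f A <= w A).

(** For [B = [set u; v]] the pieces labelled [u] and those labelled [v] split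
[A] in two: this is the classical formula for the supremum of two charges, in
a form that makes sense on a semi-ring and for any family [B]. *)
Definition partition_sums (A : S) : set R :=
  [set x | exists (I : finType) (C : I -> S) (f : I -> S -> R),
    [/\ is_partition C A, forall i, B (f i) & x = \sum_i f i (C i)]].

Definition partition_sup (A : S) : R := sup (partition_sums A).

Lemma partition_sums1 f A : B f -> partition_sums A (f A).
Proof.
move=> Bf; exists 'I_1, (fun=> A), (fun=> f).
by split=> //; [exact: is_partition1|rewrite big_ord1].
Qed.

Lemma partition_sums_le v A : charge_on v ->
  (forall f, B f -> forall A, f A <= v A) -> ubound (partition_sums A) (v A).
Proof.
move=> av Bv _ [I [C [f [pC Bf ->]]]].
by rewrite (av _ _ _ pC); apply: ler_sum => i _; exact: Bv.
Qed.

Lemma has_sup_partition_sums A : has_sup (partition_sums A).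
Proof.
split; first by exists (b A); exact: partition_sums1.
by exists (w A); exact: partition_sums_le.
Qed.

Lemma partition_sup_le v A : charge_on v ->
  (forall f, B f -> forall A, f A <= v A) -> partition_sup A <= v A.
Proof.
move=> av Bv; apply: ge_sup; last exact: partition_sums_le.
by exists (b A); exact: partition_sums1.
Qed.

Lemma partition_sup_ge A x : partition_sums A x -> x <= partition_sup A.
Proof. by apply: ub_le_sup; case: (has_sup_partition_sums A). Qed.

(** A labelled partition of [A] induces one of every [D] inside [A]; this is how
sums for [A] are compared with sums for the pieces of [A]. *)
Lemma partition_sums_meet (I J : finType) (C : J -> S) (f : J -> S -> R)
    (A D : S) : is_partition C A -> (forall j, B (f j)) ->
  \val D `<=` \val A -> partition_sums D (\sum_j f j (meet hS (C j) D)).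
Proof.
move=> pC Bf DA; exists J, (fun j => meet hS (C j) D), f; split => //.
under [X in is_partition X]funext do rewrite meetC.
exact: is_partition_meetl pC DA.
Qed.

(** [<=] by refining a partition of [A] by [D], [>=] by gluing partitions of
the [D i] together. *)
Lemma charge_on_partition_sup : charge_on partition_sup.
Proof.
move=> I D A pD; apply/eqP; rewrite eq_le; apply/andP; split.
  apply: ge_sup; first by case: (has_sup_partition_sums A).
  move=> _ [J [C [f [pC Bf ->]]]].
  have -> : \sum_j f j (C j) = \sum_i \sum_j f j (meet hS (C j) (D i)).
    rewrite exchange_big; apply: eq_bigr => j _.
    apply: (Ba (Bf j)); apply: is_partition_meetl pD _.
    exact: partition_subset pC.
  apply: ler_sum => i _; apply: partition_sup_ge.
  apply: (partition_sums_meet J pC Bf).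
  exact: partition_subset pD.
apply: sum_sup_le => [i|x xP]; first exact: has_sup_partition_sums.
(* Index type, partition and labels are packed in one type, so that a single
   choice over [i] makes them all; the index type depends on [i]. *)
have /choice[g gP] : forall i, exists g : {J : finType & J -> S * (S -> R)},
    [/\ is_partition (fun j => (projT2 g j).1) (D i),
        forall j, B (projT2 g j).2 &
        x i = \sum_j (projT2 g j).2 (projT2 g j).1].
  move=> i; have [J [C [f CfP]]] := xP i.
  by exists (existT _ J (fun j => (C j, f j))).
apply: partition_sup_ge.
exists {i : I & projT1 (g i)}, (fun u => (projT2 (g (tag u)) (tagged u)).1),
  (fun u => (projT2 (g (tag u)) (tagged u)).2); split.
- apply: (is_partition_bigcup (C := fun i j => (projT2 (g i) j).1) pD) => i.
  by have [] := gP i.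
- by move=> [i j]; have [] := gP i.
- rewrite (eq_bigr (fun i => \sum_j (projT2 (g i) j).2 (projT2 (g i) j).1)).
    exact: (sig_big_dep _ (fun=> xpredT)).
  by move=> i _; have [] := gP i.
Qed.

(** Refinement bounds the partial sums from below; superadditivity of the
nonnegative charge [partition_sup - b] bounds them from above. *)
Lemma sigma_additive_on_partition_sup :
  (forall f, B f -> sigma_additive_on f) -> sigma_additive_on partition_sup.
Proof.
move=> Bs D A pD; apply/cvgrPdist_le => e e0.
have e20 : 0 < e / 2 by rewrite divr_gt0.
have [_ [J [C [f [pC Bf ->]]]] sumC] :=
  sup_adherent e20 (has_sup_partition_sums A).
have cvgC : (fun n => \sum_j \sum_(0 <= k < n) f j (meet hS (C j) (D k))) @ \oo
    --> \sum_j f j (C j).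
  apply: cvg_big => [|j _]; first exact: add_continuous.
  apply: (Bs _ (Bf j)); apply: is_partition_meetl pD _.
  exact: partition_subset pC.
have cvgb := Bs _ Bb _ _ pD.
near=> n.
rewrite ler_distlC; apply/andP; split.
  apply: (@le_trans _ _ (\sum_j \sum_(0 <= k < n) f j (meet hS (C j) (D k)))).
    have : `|\sum_j f j (C j) -
        \sum_j \sum_(0 <= k < n) f j (meet hS (C j) (D k))| <= e / 2.
      by near: n; move/cvgrPdist_le : cvgC; apply.
    rewrite ler_distlC => /andP[+ _]; apply: le_trans.
    by rewrite /partition_sup; lra.
  rewrite exchange_big; apply: ler_sum => k _; apply: partition_sup_ge.
  apply: (partition_sums_meet J pC Bf).
  exact: partition_subset pD.
have : `|b A - \sum_(0 <= k < n) b (D k)| <= e.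
  by near: n; move/cvgrPdist_le : cvgb; apply.
rewrite ler_distlC => /andP[_ be].
have ap : charge_on (fun A => -1 * b A + partition_sup A).
  by apply: charge_on_lincomb charge_on_partition_sup; exact: Ba.
have := charge_on_sum_le hS n ap _ pD.
rewrite big_split -mulr_sumr !mulN1r /= addrC lerBlDr => sD.
apply: le_trans (sD _) _.
  move=> E; rewrite mulN1r addrC subr_ge0 partition_sup_ge//.
  exact: partition_sums1.
by rewrite addrAC addrC lerD2l addrC lerBlDr addrC.
Unshelve. all: by end_near. Qed.

(** [partition_sup] lies between [b] and [w], so that its distance to [b] is at
most [w - b], whose sum over a partition of [A] is its value at [A]. *)
Lemma partition_sup_bounded_variation :
  locally_bounded_variation b -> locally_bounded_variation partition_sup.
Proof.
move=> bb A; have [M MP] := bb A; exists (M + (- 1 * b A + w A)) => I C pC.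
rewrite (charge_on_lincomb (-1) (Ba Bb) aw pC).
apply: le_trans (lerD (MP _ _ pC) (lexx _)).
rewrite -big_split; apply: ler_sum => i _ /=.
rewrite -[partition_sup _](subrKC (b (C i))).
have sw := partition_sup_le (C i) aw Bw.
have bs := partition_sup_ge (partition_sums1 (C i) Bb).
by apply: le_trans (ler_normD _ _) _; rewrite lerD2l ger0_norm; lra.
Qed.

End partition_sup.

(** * Suprema and infima *)

Section suprema.
Context (R : realType) (Omega : Type) (S : set (set Omega)).
Context (hS : semi_ring S).
Local Notation le := (@pointwise_le S _ R).

(** The bound [w] need not belong to [ca R S]: finite additivity suffices. This
is what lets the same lemma give both Dedekind completeness and binary suprema.
*)
Lemma ca_is_lub (B : set (S -> R^o)) (w : S -> R) :
  B `<=` ca R S -> B !=set0 -> charge_on w -> (forall f, B f -> le f w) ->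
  exists s, is_lub_in (ca R S) le B s.
Proof.
move=> Bca [b Bb] aw Bw.
have Ba f : B f -> charge_on f by move=> /Bca/caP[].
exists (partition_sup B); split.
- apply/caP; split.
  + exact: (charge_on_partition_sup hS Ba aw Bb Bw).
  + by apply: (sigma_additive_on_partition_sup hS Ba aw Bb Bw) => f /Bca/caP[].
  + apply: (partition_sup_bounded_variation Ba aw Bb Bw).
    by have /caP[] := Bca _ Bb.
- by move=> f Bf A; apply: (partition_sup_ge aw Bb Bw); exact: partition_sums1.
- move=> v /caP[av _ _] Bv A.
  exact: (partition_sup_le Bb).
Qed.

Lemma ca_dedekind_complete : dedekind_complete (ca R S) le.
Proof. by move=> B Bca B0 [w /caP[aw _ _]]; exact: ca_is_lub. Qed.

Lemma charge_on_fine_variation (mu : S -> R^o) : ca R S mu ->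
  charge_on (fun A => fine (variation (fun A => (mu A)%:E) A)).
Proof.
move=> [[cmu _] vfin]; apply/charge_on_finitely_additive => n C A pC.
under eq_bigr do rewrite fineK//.
by rewrite fineK//; exact: variation_finitely_additive.
Qed.

Lemma le_fine_variation (mu : S -> R^o) : ca R S mu ->
  le mu (fun A => fine (variation (fun A => (mu A)%:E) A)).
Proof.
move=> [_ vfin] A; rewrite -lee_fin fineK//.
apply: le_trans (abse_le_variation _ A).
by rewrite lee_fin ler_norm.
Qed.

Lemma ca_sup u v : ca R S u -> ca R S v ->
  exists s, is_lub_in (ca R S) le [set u; v] s.
Proof.
move=> cu cv.
pose V (mu : S -> R^o) A := fine (variation (fun A => (mu A)%:E) A).
have V0 mu A : 0 <= V mu A by apply: fine_ge0; exact: variation_ge0.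
apply: (@ca_is_lub _ (fun A => 1 * V u A + V v A)).
- by move=> _ [|] ->.
- by exists u; left.
- by apply: charge_on_lincomb; exact: charge_on_fine_variation.
- move=> _ [|] -> A; rewrite mul1r.
    by rewrite -[leLHS]addr0 lerD//; exact: le_fine_variation.
  by rewrite -[leLHS]add0r lerD//; exact: le_fine_variation.
Qed.

Lemma caN u : ca R S u -> ca R S (- u).
Proof.
have [ca0 cal] := @ca_submod_closed R Omega S.
move=> cu; apply: set_mem; rewrite -[- u]addr0 -scaleN1r.
by apply: cal => //; exact: mem_set.
Qed.

Lemma ca_inf u v : ca R S u -> ca R S v ->
  exists s, is_glb_in (ca R S) le [set u; v] s.
Proof.
move=> cu cv; have [s [cs ubs lubs]] := ca_sup (caN cu) (caN cv).
exists (- s); split; first exact: caN.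
- by move=> _ [|] -> A; rewrite lerNl; [apply: (ubs (- u)); left|
    apply: (ubs (- v)); right].
- move=> x cx xle A; rewrite lerNr; apply: (lubs (- x)); first exact: caN.
  by move=> _ [|] -> C; rewrite lerN2; [apply: (xle u); left|
    apply: (xle v); right].
Qed.

End suprema.

Theorem theorem4p4 (R : realType) (Omega : Type) (S : set (set Omega))
    (hS : semi_ring S) :
  @riesz_space R (S -> R^o) (ca R S) (@pointwise_le S _ R) /\
  dedekind_complete (ca R S) (@pointwise_le S _ R).
Proof.
split; last exact: ca_dedekind_complete.
split.
- exact: ca_submod_closed.
- by move=> u _ A.
- by move=> u v _ _ uv vu; apply/funext => A; apply/le_anti; rewrite uv vu.
- by move=> u v w _ _ _ uv vw A; exact: (le_trans (uv A)).
- by move=> u v w _ _ _ uv A; rewrite lerD2r; exact: uv.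
- by move=> a u v _ _ a0 uv A; exact: (ler_wpM2l a0 (uv A)).
- exact: ca_sup.
- exact: ca_inf.
Qed.
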